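(* Let $M\in\mathbb{C}^{p\times p}$ be invertible, let $\mathcal{A}\in\mathbb{C}^{m\times m\times p}$ and $\mathcal{B}\in\mathbb{C}^{n\times n\times p}$ be nonsingular, let $\mathcal{C}\in\mathbb{C}^{m\times n\times p}$, and let $\mathcal{P}_1\in\mathbb{C}^{m\times m\times p}$, $\mathcal{P}_2\in\mathbb{C}^{n\times n\times p}$ be nonsingular. Let $\mathcal{P}_1*_M\mathcal{A}=\mathcal{F}_{p_1}-\mathcal{G}_{p_1}$ and $\mathcal{B}*_M\mathcal{P}_2=\mathcal{F}_{p_2}-\mathcal{G}_{p_2}$ with $\mathcal{F}_{p_1},\mathcal{F}_{p_2}$ nonsingular. Assume $0<\alpha<\frac{2}{1+\rho(\mathcal{F}_{p_1}^{-1}*_M\mathcal{G}_{p_1})}$ and $0<\beta<\frac{2}{1+\rho(\mathcal{F}_{p_2}^{-1}*_M\mathcal{G}_{p_2})}$. Given $\mathcal{X}_0\in\mathbb{C}^{m\times n\times p}$ and $\mathcal{Y}_0=\mathcal{X}_0*_M\mathcal{B}$, define for $k\ge0$ $$\mathcal{Y}_{k+1}=(\mathcal{I}_{mmp}-\alpha\mathcal{F}_{p_1}^{-1}*_M\mathcal{P}_1*_M\mathcal{A})*_M\mathcal{Y}_k+\alpha\mathcal{F}_{p_1}^{-1}*_M\mathcal{P}_1*_M\mathcal{C}*_M\mathcal{P}_2,$$ $$\mathcal{X}_{k+1}=\mathcal{X}_k*_M(\mathcal{I}_{nnp}-\beta\mathcal{B}*_M\mathcal{P}_2*_M\mathcal{F}_{p_2}^{-1})+\beta\mathcal{Y}_{k+1}*_M\mathcal{F}_{p_2}^{-1}.$$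 If $\rho(\mathcal{F}_{p_1}^{-1}*_M\mathcal{G}_{p_1})<1$ and $\rho(\mathcal{F}_{p_2}^{-1}*_M\mathcal{G}_{p_2})<1$, then for every initial tensor $\mathcal{X}_0$ (with $\mathcal{Y}_0=\mathcal{X}_0*_M\mathcal{B}$) the sequence $\{\mathcal{X}_k\}$ converges to $$(\mathcal{P}_1*_M\mathcal{A})^{-1}*_M\mathcal{P}_1*_M\mathcal{C}*_M\mathcal{P}_2*_M(\mathcal{B}*_M\mathcal{P}_2)^{-1}=\mathcal{A}^{-1}*_M\mathcal{C}*_M\mathcal{B}^{-1}.$$
   Context: For $\mathcal{A}\in\mathbb{C}^{m\times n\times p}$, $\mathcal{A}(:,:,i)\in\mathbb{C}^{m\times n}$ ($1\le i\le p$) denotes the $i$-th frontal slice. For the fixed invertible matrix $M\in\mathbb{C}^{p\times p}$, $\tilde{\mathcal{A}}:=\mathcal{A}\times_3 M$ is defined by $\tilde{\mathcal{A}}(i_1,i_2,k)=\sum_{i_3=1}^p \mathcal{A}(i_1,i_2,i_3)M(k,i_3)$. The $M$-product of $\mathcal{A}\in\mathbb{C}^{m\times n\times p}$ and $\mathcal{B}\in\mathbb{C}^{n\times k\times p}$ is the tensor $\mathcal{A}*_M\mathcal{B}\in\mathbb{C}^{m\times k\times p}$ given by $\mathcal{A}*_M\mathcal{B}=\mathcal{W}\times_3 M^{-1}$, where $\mathcal{W}(:,:,i)=\tilde{\mathcal{A}}(:,:,i)\,\tilde{\mathcal{B}}(:,:,i)$ for $i=1,\dots,p$. The identity tensor $\mathcal{I}_{mmp}\in\mathbb{C}^{m\times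 m\times p}$ is the tensor such that each $\tilde{\mathcal{I}}_{mmp}(:,:,i)$ is the $m\times m$ identity matrix. $\mathcal{A}\in\mathbb{C}^{m\times m\times p}$ is nonsingular (invertible) if there is $\mathcal{Z}=:\mathcal{A}^{-1}$ with $\mathcal{A}*_M\mathcal{Z}=\mathcal{Z}*_M\mathcal{A}=\mathcal{I}_{mmp}$. The spectral radius of $\mathcal{A}\in\mathbb{C}^{m\times m\times p}$ is $\rho(\mathcal{A})=\max_{1\le i\le p}\rho(\tilde{\mathcal{A}}(:,:,i))$. Convergence of tensors is in the finite-dimensional space (entrywise). *)

(* Defs.v *)
From HB Require Import structures.
From mathcomp Require Import all_boot all_order all_algebra.
From mathcomp Require Import complex.
From mathcomp Require Import all_classical all_reals all_analysis.

Set Implicit Arguments.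
Unset Strict Implicit.
Unset Printing Implicit Defensive.

Import Order.TTheory GRing.Theory Num.Theory.
Import numFieldNormedType.Exports.

Local Open Scope classical_set_scope.
Local Open Scope ring_scope.
Local Open Scope complex_scope.

(* A third-order tensor is the family of its frontal slices: [A k] is
   A(:,:,k), and the entry A(i,j,k) is [A k i j]. *)
Notation "''T[' R ]_ ( m , n , p )" := {ffun 'I_p -> 'M[R]_(m, n)}
  (at level 8, format "''T[' R ]_ ( m ,  n ,  p )") : type_scope.

Definition mode3 (R : realType) (m n p q : nat)
    (A : 'T[R[i]]_(m, n, p)) (U : 'M[R[i]]_(q, p)) : 'T[R[i]]_(m, n, q) :=
  [ffun k => \matrix_(i < m, j < n) \sum_(l < p) A l i j * U k l].

Definition tmul (R : realType) (p : nat) (M : 'M[R[i]]_p) (m n k : nat)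
    (A : 'T[R[i]]_(m, n, p)) (B : 'T[R[i]]_(n, k, p)) : 'T[R[i]]_(m, k, p) :=
  mode3 [ffun s => mode3 A M s *m mode3 B M s] (invmx M).

Notation "A *_[ M ] B" := (tmul M A B)
  (at level 40, left associativity, format "A  *_[ M ]  B") : ring_scope.

(* For invertible M this is the only tensor whose transform [mode3 _ M] has
   all frontal slices equal to the identity matrix. *)
Definition tid (R : realType) (p : nat) (M : 'M[R[i]]_p) (m : nat) :
    'T[R[i]]_(m, m, p) :=
  mode3 [ffun _ => 1%:M] (invmx M).

Definition is_tinv (R : realType) (p : nat) (M : 'M[R[i]]_p) (m : nat)
    (A Z : 'T[R[i]]_(m, m, p)) : Prop :=
  A *_[M] Z = tid M m /\ Z *_[M] A = tid M m.

Definition tnonsingular (R : realType) (p : nat) (M : 'M[R[i]]_p) (m : nat)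
    (A : 'T[R[i]]_(m, m, p)) : Prop :=
  exists Z, is_tinv M A Z.

(* Junk value 0 when A is singular. *)
Definition tinv (R : realType) (p : nat) (M : 'M[R[i]]_p) (m : nat)
    (A : 'T[R[i]]_(m, m, p)) : 'T[R[i]]_(m, m, p) :=
  xget 0 [set Z | is_tinv M A Z].

(* The set of eigenvalue moduli is finite, so its supremum is a maximum when
   n > 0; for n = 0 the value is [sup set0 = 0]. *)
Definition spectral_radius (R : realType) (n : nat) (A : 'M[R[i]]_n) : R :=
  sup [set ComplexField.Normc.normc l | l in [set l | eigenvalue A l]].

(* Spectral radii are nonnegative, so the base value 0 of the iterated maximum
   only matters for p = 0. *)
Definition tspectral_radius (R : realType) (p : nat) (M : 'M[R[i]]_p) (m : nat)
    (A : 'T[R[i]]_(m, m, p)) : R :=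
  \big[Num.max/0]_(k < p) spectral_radius (mode3 A M k).

(* [R[i]^o] carries the topology of the complex modulus. *)
Definition tcvg (R : realType) (m n p : nat)
    (X : nat -> 'T[R[i]]_(m, n, p)) (L : 'T[R[i]]_(m, n, p)) : Prop :=
  forall (i : 'I_m) (j : 'I_n) (k : 'I_p),
    ((fun t => X t k i j) : nat -> R[i]^o) @ \oo --> (L k i j : R[i]^o).

(* Main.v *)
(** The transform [A |-> mode3 A M] turns the M-product into the slicewise matrix
    product, so everything reduces to two coupled affine recursions of matrices.
    By the splitting, the iteration matrix of [Y] is
    [(1 - alpha) 1 + alpha F1^-1 G1], with eigenvalues of modulus at most
    [|1 - alpha| + alpha rho < 1]; hence [Y] converges to its fixed point. The
    iteration matrix of [X] is handled likewise, its inhomogeneous term being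
    convergent rather than constant.

    That [v k.+1 = v k *m S + b k] with [b] tending to 0 forces [v] to tend to 0
    when the eigenvalues of [S] lie in the open unit disc is obtained without
    matrix norms or normal forms: Cayley-Hamilton kills the product of the
    [S - z] over the roots [z] of the characteristic polynomial, and these
    factors are removed one at a time, which leaves scalar recursions. *)
Require Import Defs.
From HB Require Import structures.
From mathcomp Require Import all_boot all_order all_algebra.
From mathcomp Require Import complex.
From mathcomp Require Import all_classical all_reals all_analysis.
From mathcomp Require Import ring lra.

Set Implicit Arguments.
Unset Strict Implicit.
Unset Printing Implicit Defensive.

Import Order.TTheory GRing.Theory Num.Theory.
Import numFieldNormedType.Exports.

Local Open Scope ring_scope.
Local Open Scope complex_scope.

(** * Scalar sequences and complex moduli *)

Lemma cvg0_contraction_perturb (R : realType) (q : R) (e d : nat -> R) :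
  0 <= q < 1 -> (forall k, 0 <= e k) -> (forall k, e k.+1 <= q * e k + d k) ->
  (d @ \oo --> (0 : R))%classic -> (e @ \oo --> (0 : R))%classic.
Proof.
move=> /andP[q0 q1] e0 es d0.
have q1' : 0 < 1 - q by rewrite subr_gt0.
apply/cvgrPdist_le => eps eps0.
(* With [d] eventually at most this bound, [eps / 2] is the fixed point of
   [x |-> q * x + eps / 2 * (1 - q)], so the induction [eN] leaves only a geometric term above
   it. *)
have eta0 : 0 < eps / 2 * (1 - q) by rewrite mulr_gt0// divr_gt0.
have /cvgrPdist_le/(_ _ eta0)[N _ dN] := d0.
have eN j : e (j + N)%N <= q ^+ j * e N + eps / 2.
  elim: j => [|j IH]; first by rewrite add0n expr0 mul1r lerDl divr_ge0// ltW.
  rewrite addSn (le_trans (es _))//.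
  have /= := dN (j + N)%N (leq_addl _ _).
  rewrite sub0r normrN => /(le_trans (ler_norm _)) dj.
  by apply: le_trans (lerD (ler_wpM2l q0 IH) dj) _; rewrite exprS; lra.
have : ((fun j => q ^+ j * e N) @ \oo --> 0 * e N)%classic.
  by apply: cvgMr_tmp; apply: cvg_expr; rewrite ger0_norm.
have eps20 : 0 < eps / 2 by rewrite divr_gt0.
rewrite mul0r => /cvgrPdist_le/(_ _ eps20)[J _ qJ].
exists (J + N)%N => // k /= kJN.
rewrite sub0r normrN ger0_norm//.
have kN : (N <= k)%N by apply: leq_trans kJN; apply: leq_addl.
rewrite -(subnK kN) (le_trans (eN _))//.
have Jk : (J <= k - N)%N by rewrite leq_subRL// addnC.
have /= := qJ _ Jk.
by rewrite sub0r normrN => /(le_trans (ler_norm _)) h; lra.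
Qed.

Local Notation normc := ComplexField.Normc.normc.

Lemma normc_normr (R : realType) (z : R[i]) : `|z| = (normc z)%:C.
Proof. by case: z. Qed.

Lemma normc_ge0 (R : realType) (z : R[i]) : 0 <= normc z.
Proof. by rewrite -lecR -normc_normr normr_ge0. Qed.

Lemma normc_real (R : realType) (a : R) : normc a%:C = `|a|.
Proof. by rewrite /= expr0n addr0 sqrtr_sqr. Qed.

Lemma cvg0_normc (R : realType) (a : nat -> R[i]) :
  ((a : nat -> R[i]^o) @ \oo --> (0 : R[i]^o))%classic <->
  ((fun t => normc (a t)) @ \oo --> (0 : R))%classic.
Proof.
split=> [/cvgrPdist_lt a0 | /cvgrPdist_lt a0]; apply/cvgrPdist_lt => eps eps0.
  have := a0 eps%:C; rewrite ltcR => /(_ eps0)[N _ aN]; exists N => // k /aN /=.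
  rewrite !sub0r !normrN => h.
  by rewrite ger0_norm ?normc_ge0// -ltcR -normc_normr.
(* Positivity in [R[i]] forces a zero imaginary part, so the real part of [eps] serves as the real
   tolerance. *)
move: eps0; rewrite ltcE => /andP[/eqP /= ei er].
have [N _ aN] := a0 _ er; exists N => // k /aN /=.
rewrite !sub0r !normrN ger0_norm ?normc_ge0// => h.
by rewrite [`|_|](normc_normr (a k)) ltcE /= ei eqxx.
Qed.

Definition mxcvg (R : realType) (m n : nat)
    (V : nat -> 'M[R[i]]_(m, n)) (L : 'M[R[i]]_(m, n)) : Prop :=
  forall i j,
    (((fun t => V t i j) : nat -> R[i]^o) @ \oo
      --> (L i j : R[i]^o))%classic.

(** Eigenvectors are rows here, but the characteristic polynomial is invariant under transposition.
    This lets left recursions be transposed into right ones. *)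
Lemma eigenvalue_tr (F : fieldType) (n : nat) (S : 'M[F]_n) :
  eigenvalue S^T =1 eigenvalue S.
Proof.
move=> z; rewrite !eigenvalue_root_char; congr (root _ z).
rewrite /char_poly -det_tr; congr (\det _); apply/matrixP => i j.
by rewrite !mxE eq_sym.
Qed.

(** * Entrywise limits and affine recursions of matrices *)

Section MatrixSequences.
Variable R : realType.
Local Notation C := R[i].

Lemma cvg_sumC (I : finType) (f : I -> nat -> C) (l : I -> C) :
  (forall i, ((f i : nat -> C^o) @ \oo --> (l i : C^o))%classic) ->
  (((fun t => \sum_i f i t) : nat -> C^o) @ \oo
    --> (\sum_i l i : C^o))%classic.
Proof. by move=> fl; apply: cvg_big => [|i _]; [exact: add_continuous|]. Qed.

Lemma mxcvg_ext (m n : nat) (U V : nat -> 'M[C]_(m, n)) K :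
  U =1 V -> mxcvg U K -> mxcvg V K.
Proof. by move=> UV; have -> : U = V by apply/funext. Qed.

Lemma mxcvg_cst (m n : nat) (K : 'M[C]_(m, n)) : mxcvg (fun=> K) K.
Proof. by move=> i j; apply: cvg_cst. Qed.

Lemma mxcvgD (m n : nat) (U V : nat -> 'M[C]_(m, n)) K L :
  mxcvg U K -> mxcvg V L -> mxcvg (fun t => U t + V t) (K + L).
Proof.
move=> UK VL i j; rewrite mxE.
under eq_cvg do rewrite mxE.
by apply: (@cvgD _ C^o); [exact: UK | exact: VL].
Qed.

Lemma mxcvgM (m n k : nat) (U : nat -> 'M[C]_(m, n))
    (V : nat -> 'M[C]_(n, k)) K L :
  mxcvg U K -> mxcvg V L -> mxcvg (fun t => U t *m V t) (K *m L).
Proof.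
move=> UK VL i j; rewrite mxE.
under eq_cvg do rewrite mxE.
by apply: cvg_sumC => l; apply: cvgM; [exact: UK | exact: VL].
Qed.

Lemma mxcvg_tr (m n : nat) (U : nat -> 'M[C]_(m, n)) K :
  mxcvg U K -> mxcvg (fun t => (U t)^T) K^T.
Proof.
move=> UK i j; rewrite mxE; under eq_cvg do rewrite mxE.
exact: UK.
Qed.

Lemma mxcvgS (m n : nat) (U : nat -> 'M[C]_(m, n)) K :
  mxcvg (fun t => U t.+1) K <-> mxcvg U K.
Proof.
by split=> UK i j; have := UK i j;
  rewrite -(cvg_shiftS (fun t => U t i j : C^o)).
Qed.

Lemma cvg0_recr (z : C) (a b : nat -> C) : `|z| < 1 ->
  (forall k, a k.+1 = z * a k + b k) ->
  ((b : nat -> C^o) @ \oo --> (0 : C^o))%classic ->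
  ((a : nat -> C^o) @ \oo --> (0 : C^o))%classic.
Proof.
rewrite normc_normr (ltcR _ 1) => z1 ab /cvg0_normc b0; apply/cvg0_normc.
apply: (@cvg0_contraction_perturb _ (normc z)) b0.
- by rewrite normc_ge0.
- by move=> k; apply: normc_ge0.
- by move=> k; rewrite ab -ComplexField.Normc.normcM le_normcD.
Qed.

(* Peel off one factor at a time: with [u = v *m (S - z)] the recursion reads
   [v k.+1 = z *: v k + (u k + b k)], and [u] satisfies the same recursion as
   [v] with one factor fewer. *)
Lemma mxcvg0_recr_prod (m n : nat) (S : 'M[C]_n.+1) (rs : seq C)
    (v b : nat -> 'M[C]_(m, n.+1)) :
  (forall z, z \in rs -> `|z| < 1) ->
  (forall k, v k.+1 = v k *m S + b k) -> mxcvg b 0 ->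
  mxcvg (fun k => v k *m \prod_(z <- rs) (S - z%:M)) 0 -> mxcvg v 0.
Proof.
elim: rs v b => [|z rs IH] v b rs1 vS b0.
  by apply: mxcvg_ext => k; rewrite big_nil mulmx1.
move=> v0; pose u k := v k *m (S - z%:M).
have u0 : mxcvg u 0.
  apply: (IH _ (fun k => b k *m (S - z%:M))).
  - by move=> y yrs; apply: rs1; rewrite in_cons yrs orbT.
  (* [S] commutes with [S - z%:M], so [u] obeys the recursion of [v] with [b] multiplied by that
     factor. *)
  - move=> k; rewrite /u vS mulmxDl -!mulmxA; congr (v k *m _ + _).
    by rewrite mulmxBr mulmxBl scalar_mxC.
  - by have := mxcvgM b0 (@mxcvg_cst _ _ (S - z%:M)); rewrite mul0mx.
  - by apply: mxcvg_ext v0 => k; rewrite /u -mulmxA big_cons.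
have ub0 : mxcvg (fun k => u k + b k) 0 by rewrite -[0]addr0; apply: mxcvgD.
move=> i j; rewrite mxE.
apply: (@cvg0_recr z _ (fun k => (u k + b k) i j)).
- by apply: rs1; rewrite mem_head.
- move=> k; rewrite vS /u mulmxBr mul_mx_scalar !mxE; ring.
- by have := ub0 i j; rewrite mxE.
Qed.

(** Subtracting the fixed point [L] leaves the same recursion for [v - L], with the vanishing
    perturbation [b - c]. *)
Lemma mxcvg_affine_recr (m n : nat) (S : 'M[C]_n) (v b : nat -> 'M[C]_(m, n))
    (c L : 'M[C]_(m, n)) :
  (forall z, eigenvalue S z -> `|z| < 1) ->
  (forall k, v k.+1 = v k *m S + b k) -> mxcvg b c -> L = L *m S + c ->
  mxcvg v L.
Proof.
(* A matrix without columns has no entry to check; [mxcvg0_recr_prod] expects a positive size. *)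
case: n S v b c L => [|n] S v b c L S1 vS bc LS; first by move=> i [].
have : mxcvg (fun k => v k - L) 0.
  have [rs Ers] := closed_field_poly_normal (char_poly S).
  have charS : char_poly S = \prod_(z <- rs) ('X - z%:P).
    by rewrite {1}Ers (monicP (char_poly_monic S)) scale1r.
  apply: (@mxcvg0_recr_prod _ _ S rs _ (fun k => b k - c)).
  - move=> z zrs; apply: S1.
    by rewrite eigenvalue_root_char charS root_prod_XsubC.
  - by move=> k; rewrite vS {1}LS mulmxBl opprD addrACA.
  - by have := mxcvgD bc (@mxcvg_cst _ _ (- c)); rewrite subrr.
  (* This product is the characteristic polynomial evaluated at [S], so the fully multiplied
     sequence is identically zero. *)
  - have -> : \prod_(z <- rs) (S - z%:M) = 0.
      rewrite -(Cayley_Hamilton S) charS rmorph_prod; apply: eq_bigr => z _.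
      by rewrite rmorphB /= horner_mx_X horner_mx_C.
    by apply: mxcvg_ext (@mxcvg_cst _ _ 0) => k; rewrite mulmx0.
move=> /mxcvgD/(_ (@mxcvg_cst _ _ L)); rewrite add0r.
by apply: mxcvg_ext => k; rewrite subrK.
Qed.

Lemma mxcvg_affine_recl (m n : nat) (S : 'M[C]_m) (v b : nat -> 'M[C]_(m, n))
    (c L : 'M[C]_(m, n)) :
  (forall z, eigenvalue S z -> `|z| < 1) ->
  (forall k, v k.+1 = S *m v k + b k) -> mxcvg b c -> L = S *m L + c ->
  mxcvg v L.
Proof.
move=> S1 vS bc LS.
have : mxcvg (fun k => (v k)^T) L^T.
  apply: (@mxcvg_affine_recr _ _ S^T _ (fun k => (b k)^T) c^T).
  - by move=> z; rewrite eigenvalue_tr; apply: S1.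
  - by move=> k; rewrite vS linearD /= trmx_mul.
  - exact: mxcvg_tr.
  - by rewrite {1}LS linearD /= trmx_mul.
by move=> /mxcvg_tr; rewrite trmxK; apply: mxcvg_ext => k; rewrite trmxK.
Qed.

End MatrixSequences.

(** * Eigenvalues of relaxed iteration matrices *)

Lemma normc_le_spectral_radius (R : realType) (n : nat) (S : 'M[R[i]]_n) z :
  eigenvalue S z -> normc z <= spectral_radius S.
Proof.
move=> Sz; apply: ub_le_sup; last by exists z.
have [rs Ers] := closed_field_poly_normal (char_poly S).
(* [sup] dominates its set only once the set is known to be bounded; the sum of the moduli of all
   characteristic roots is a crude bound. *)
exists (\sum_(y <- rs) normc y) => _ [y /= Sy <-].
have yrs : y \in rs.
  move: Sy; rewrite eigenvalue_root_char Ers (monicP (char_poly_monic S)).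
  by rewrite scale1r root_prod_XsubC.
rewrite (big_rem y yrs) /= lerDl sumr_ge0// => x _; exact: normc_ge0.
Qed.

(** The modulus is at most [|1 - a| + a * r]: for [a <= 1] this is [1 - a * (1 - r) < 1], and for
    [a > 1] it is [a * (1 + r) - 1], below 1 exactly by the bound on [a]. The separate [r] lets a
    slice be estimated by the spectral radius of the whole tensor. *)
Lemma norm_eigenvalue_relax (R : realType) (n : nat) (S T : 'M[R[i]]_n)
    (a r : R) :
  (forall z, eigenvalue T z -> exists2 y, eigenvalue S y &
     z = 1 - a%:C + a%:C * y) ->
  0 < a -> 0 <= r < 1 -> spectral_radius S <= r -> a < 2 / (1 + r) ->
  forall z, eigenvalue T z -> `|z| < 1.
Proof.
move=> TS a0 /andP[r0 r1] Sr; rewrite ltr_pdivlMr; last by lra.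
move=> ar z Tz; have [y Sy ->] := TS z Tz.
have yr := le_trans (normc_le_spectral_radius Sy) Sr.
have -> : 1 - a%:C = (1 - a)%:C :> R[i] by rewrite rmorphB.
apply: le_lt_trans (ler_normD _ _) _.
rewrite normrM !normc_normr !normc_real (gtr0_norm a0).
rewrite -rmorphM -rmorphD (ltcR _ 1).
have ay : a * normc y <= a * r by rewrite ler_pM2l.
have ar1 : a * r < a by rewrite gtr_pMr.
by have [h|h] := leP 0 (1 - a); [rewrite ger0_norm | rewrite ltr0_norm]; lra.
Qed.

Lemma invmx_mul (F : comUnitRingType) (n : nat) (A B : 'M[F]_n) :
  A \in unitmx -> B \in unitmx -> invmx (A *m B) = invmx B *m invmx A.
Proof.
move=> uA uB; have uAB : A *m B \in unitmx by rewrite unitmx_mul uA.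
by apply: (can_inj (mulKmx uAB)); rewrite mulmxV// mulmxA mulmxK// mulmxV.
Qed.

(* For a splitting [N = F - G], both relaxed iteration matrices are
   [1 - a + a * J] with [J = F^-1 G] or [J = G F^-1], and these two [J] are
   similar through [F]. *)
Lemma eigenvalue_relaxl (K : fieldType) (n : nat) (F G : 'M[K]_n) (a z : K) :
  F \in unitmx -> a != 0 ->
  eigenvalue (1%:M - a *: (invmx F *m (F - G))) z ->
  exists2 y, eigenvalue (invmx F *m G) y & z = 1 - a + a * y.
Proof.
move=> uF a0 /eigenvalueP[v vz v0].
(* Obtained by solving [z = 1 - a + a * y] for [y]. *)
exists ((z - 1 + a) / a); last by field.
apply/eigenvalueP; exists v => //.
have : a *: (v *m (invmx F *m G)) = (z - 1 + a) *: v.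
  rewrite scalerDl scalerBl scale1r -vz [invmx F *m (_ - _)]mulmxBr (mulVmx uF).
  rewrite mulmxBr mulmx1 -scalemxAr mulmxBr mulmx1 scalerBr.
  by rewrite opprB [v + _]addrC addrK subrK.
by move=> /(congr1 ( *:%R a^-1)); rewrite !scalerA mulVf// scale1r mulrC.
Qed.

Lemma eigenvalue_relaxr (K : fieldType) (n : nat) (F G : 'M[K]_n) (a z : K) :
  F \in unitmx -> a != 0 ->
  eigenvalue (1%:M - a *: ((F - G) *m invmx F)) z ->
  exists2 y, eigenvalue (invmx F *m G) y & z = 1 - a + a * y.
Proof.
move=> uF a0 /eigenvalueP[v vz v0]; apply: eigenvalue_relaxl => //.
(* Since [v (F - G) F^-1 F = (v F) F^-1 (F - G)], right multiplication by [F] carries row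
   eigenvectors over. *)
apply/eigenvalueP; exists (v *m F).
  rewrite scalemxAl -vz mulmxBr [v *m (_ - _)]mulmxBr [RHS]mulmxBl !mulmx1.
  rewrite -!scalemxAr -scalemxAl.
  by rewrite !mulmxA mulmxKV// mulmxK.
by apply: contra v0 => /eqP vF; rewrite -[v](mulmxK uF) vF mul0mx.
Qed.

(* Locked, since unfolding [mode3] during unification is prohibitively slow. *)
HB.lock Definition mslice (R : realType) (p : nat) (M : 'M[R[i]]_p)
  (m n : nat) (A : 'T[R[i]]_(m, n, p)) (k : 'I_p) : 'M[R[i]]_(m, n) :=
  mode3 A M k.

(** * From M-products to slicewise matrix products *)

Section Transform.
Variables (R : realType) (p : nat) (M : 'M[R[i]]_p).
Hypothesis uM : M \in unitmx.
Local Notation C := R[i].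

Lemma mode3_comp (m n q r s : nat) (A : 'T[C]_(m, n, q)) (U : 'M[C]_(r, q))
    (V : 'M[C]_(s, r)) : mode3 (mode3 A U) V = mode3 A (V *m U).
Proof.
apply/ffunP => k; rewrite !ffunE; apply/matrixP => i j; rewrite !mxE.
under eq_bigr do rewrite !ffunE mxE mulr_suml.
rewrite exchange_big; apply: eq_bigr => l _; rewrite mxE mulr_sumr.
by apply: eq_bigr => t _; ring.
Qed.

Lemma mode3_1 (m n q : nat) (A : 'T[C]_(m, n, q)) : mode3 A 1%:M = A.
Proof.
apply/ffunP => k; rewrite !ffunE; apply/matrixP => i j; rewrite !mxE.
rewrite (bigD1 k) //= big1 => [|l /negPf lk].
  by rewrite mxE eqxx mulr1 addr0.
by rewrite mxE eq_sym lk mulr0.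
Qed.

Lemma mode3K (m n : nat) (A : 'T[C]_(m, n, p)) :
  mode3 (mode3 A M) (invmx M) = A.
Proof. by rewrite mode3_comp mulVmx// mode3_1. Qed.

Lemma mode3VK (m n : nat) (A : 'T[C]_(m, n, p)) :
  mode3 (mode3 A (invmx M)) M = A.
Proof. by rewrite mode3_comp mulmxV// mode3_1. Qed.

Lemma mslice_inj (m n : nat) (A B : 'T[C]_(m, n, p)) :
  (forall k, mslice M A k = mslice M B k) -> A = B.
Proof.
by rewrite mslice.unlock => /ffunP AB; rewrite -(mode3K A) AB mode3K.
Qed.

Lemma msliceM (m n q : nat) (A : 'T[C]_(m, n, p)) (B : 'T[C]_(n, q, p)) k :
  mslice M (A *_[M] B) k = mslice M A k *m mslice M B k.
Proof. by rewrite mslice.unlock /tmul mode3VK ffunE. Qed.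

Lemma mslice1 (m : nat) k : mslice M (tid M m) k = 1%:M.
Proof. by rewrite mslice.unlock /tid mode3VK ffunE. Qed.

Lemma msliceD (m n : nat) (A B : 'T[C]_(m, n, p)) k :
  mslice M (A + B) k = mslice M A k + mslice M B k.
Proof.
rewrite mslice.unlock !ffunE; apply/matrixP => i j; rewrite !mxE -big_split.
by apply: eq_bigr => l _; rewrite !ffunE mxE mulrDl.
Qed.

Lemma msliceZ (m n : nat) (a : C) (A : 'T[C]_(m, n, p)) k :
  mslice M (a *: A) k = a *: mslice M A k.
Proof.
rewrite mslice.unlock !ffunE; apply/matrixP => i j; rewrite !mxE mulr_sumr.
by apply: eq_bigr => l _; rewrite !ffunE mxE mulrA.
Qed.

Lemma msliceB (m n : nat) (A B : 'T[C]_(m, n, p)) k :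
  mslice M (A - B) k = mslice M A k - mslice M B k.
Proof. by rewrite -scaleN1r msliceD msliceZ scaleN1r. Qed.

(** Nonsingularity rules out the junk value of [tinv]; slicewise, a one-sided inverse of a square
    matrix is the inverse. *)
Lemma mslice_tinv (m : nat) (A : 'T[C]_(m, m, p)) k : tnonsingular M A ->
  mslice M A k \in unitmx /\ mslice M (tinv M A) k = invmx (mslice M A k).
Proof.
move=> nA; have [] : is_tinv M A (tinv M A) := xgetPex 0 nA.
move=> /(congr1 (fun T => mslice M T k)); rewrite msliceM mslice1 => AV _.
have [uA _] := mulmx1_unit AV; split=> //.
by rewrite -[RHS]mulmx1 -AV mulKmx.
Qed.

Lemma tmulA (m n q r : nat) (A : 'T[C]_(m, n, p)) (B : 'T[C]_(n, q, p))
    (D : 'T[C]_(q, r, p)) : A *_[M] (B *_[M] D) = A *_[M] B *_[M] D.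
Proof.
apply: (@mslice_inj m r) => // k.
by rewrite (msliceM A) (msliceM B) (msliceM _ D) (msliceM A B) mulmxA.
Qed.

Lemma tmul1 (m n : nat) (A : 'T[C]_(m, n, p)) : A *_[M] tid M n = A.
Proof.
by apply: (@mslice_inj m n) => // k; rewrite (msliceM A) mslice1 mulmx1.
Qed.

Lemma tnonsingularM (m : nat) (A B : 'T[C]_(m, m, p)) :
  tnonsingular M A -> tnonsingular M B -> tnonsingular M (A *_[M] B).
Proof.
move=> [A' [AA' A'A]] [B' [BB' B'B]]; exists (B' *_[M] A'); split.
  by rewrite tmulA -(tmulA A) BB' tmul1.
by rewrite tmulA -(tmulA B') A'A tmul1.
Qed.

(** Undoing the transform writes each entry of [X t] as a finite combination of slice entries, with
    fixed coefficients from [invmx M]. *)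
Lemma tcvg_mslice (m n : nat) (X : nat -> 'T[C]_(m, n, p)) L :
  (forall k, mxcvg (fun t => mslice M (X t) k) (mslice M L k)) -> tcvg X L.
Proof.
rewrite mslice.unlock => XL i j k; rewrite -[L]mode3K ffunE mxE.
under eq_cvg do rewrite -[X _]mode3K ffunE mxE.
by apply: cvg_sumC => l; apply: cvgMr_tmp; apply: XL.
Qed.

Lemma spectral_radius_le (m : nat) (A : 'T[C]_(m, m, p)) k :
  spectral_radius (mslice M A k) <= tspectral_radius M A.
Proof.
rewrite mslice.unlock.
exact: (le_bigmax 0 (fun k => spectral_radius (mode3 A M k))).
Qed.

Lemma tspectral_radius_ge0 (m : nat) (A : 'T[C]_(m, m, p)) :
  0 <= tspectral_radius M A.
Proof. by rewrite /tspectral_radius; apply: bigmax_ge_id. Qed.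

End Transform.

Theorem theorem3p18 (R : realType) (m n p : nat) (M : 'M[R[i]]_p)
    (A : 'T[R[i]]_(m, m, p)) (B : 'T[R[i]]_(n, n, p)) (C : 'T[R[i]]_(m, n, p))
    (P1 : 'T[R[i]]_(m, m, p)) (P2 : 'T[R[i]]_(n, n, p))
    (F1 G1 : 'T[R[i]]_(m, m, p)) (F2 G2 : 'T[R[i]]_(n, n, p))
    (alpha beta : R)
    (hM : M \in unitmx)
    (hA : tnonsingular M A) (hB : tnonsingular M B)
    (hP1 : tnonsingular M P1) (hP2 : tnonsingular M P2)
    (hsplit1 : P1 *_[M] A = F1 - G1) (hsplit2 : B *_[M] P2 = F2 - G2)
    (hF1 : tnonsingular M F1) (hF2 : tnonsingular M F2)
    (halpha0 : 0 < alpha)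
    (halpha : alpha < 2 / (1 + tspectral_radius M (tinv M F1 *_[M] G1)))
    (hbeta0 : 0 < beta)
    (hbeta : beta < 2 / (1 + tspectral_radius M (tinv M F2 *_[M] G2)))
    (hrho1 : tspectral_radius M (tinv M F1 *_[M] G1) < 1)
    (hrho2 : tspectral_radius M (tinv M F2 *_[M] G2) < 1) :
  (forall (X0 : 'T[R[i]]_(m, n, p)) (X Y : nat -> 'T[R[i]]_(m, n, p)),
     X 0%N = X0 ->
     Y 0%N = X0 *_[M] B ->
     (forall k : nat,
        Y k.+1 = (tid M m - alpha%:C *: (tinv M F1 *_[M] P1 *_[M] A)) *_[M] Y k
                 + alpha%:C *: (tinv M F1 *_[M] P1 *_[M] C *_[M] P2)) ->
     (forall k : nat,
        X k.+1 = X k *_[M] (tid M n - beta%:C *: (B *_[M] P2 *_[M] tinv M F2))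
                 + beta%:C *: (Y k.+1 *_[M] tinv M F2)) ->
     tcvg X (tinv M (P1 *_[M] A) *_[M] P1 *_[M] C *_[M] P2
             *_[M] tinv M (B *_[M] P2)))
  /\ tinv M (P1 *_[M] A) *_[M] P1 *_[M] C *_[M] P2 *_[M] tinv M (B *_[M] P2)
     = tinv M A *_[M] C *_[M] tinv M B.
Proof.
have uA k := (mslice_tinv hM k hA).1; have uB k := (mslice_tinv hM k hB).1.
have uP1 k := (mslice_tinv hM k hP1).1; have uP2 k := (mslice_tinv hM k hP2).1.
have limE : tinv M (P1 *_[M] A) *_[M] P1 *_[M] C *_[M] P2
    *_[M] tinv M (B *_[M] P2) = tinv M A *_[M] C *_[M] tinv M B.
  have hPA k := (mslice_tinv hM k (tnonsingularM hM hP1 hA)).2.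
  have hBP k := (mslice_tinv hM k (tnonsingularM hM hB hP2)).2.
  have hAV k := (mslice_tinv hM k hA).2; have hBV k := (mslice_tinv hM k hB).2.
  (* Only the slices of these inverses matter from here on, so the tensors themselves are
     abstracted. *)
  move: (tinv M A) (tinv M B) (tinv M (P1 *_[M] A)) (tinv M (B *_[M] P2))
    hAV hBV hPA hBP => Ai Bi PAi BPi hAV hBV hPA hBP.
  apply: (@mslice_inj _ _ _ hM m n) => k.
  rewrite !(msliceM hM) hAV hBV hPA hBP !(msliceM hM).
  by rewrite !invmx_mul// !mulmxA mulmxKV// mulmxK.
have hAV k := (mslice_tinv hM k hA).2; have hBV k := (mslice_tinv hM k hB).2.
split=> [X0 X Y _ _ YS XS|//]; rewrite limE; apply: (tcvg_mslice hM) => k.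
have [uF1 F1V] := mslice_tinv hM k hF1; have [uF2 F2V] := mslice_tinv hM k hF2.
have split1 : mslice M P1 k *m mslice M A k = mslice M F1 k - mslice M G1 k.
  by rewrite -(msliceM hM) hsplit1 msliceB.
have split2 : mslice M B k *m mslice M P2 k = mslice M F2 k - mslice M G2 k.
  by rewrite -(msliceM hM) hsplit2 msliceB.
have alphaC : alpha%:C != 0 :> R[i] by rewrite (inj_eq (@complexI _)) gt_eqF.
have betaC : beta%:C != 0 :> R[i] by rewrite (inj_eq (@complexI _)) gt_eqF.
(* The slice of [A^-1 C P2] is fixed by the [Y] step: the correction [alpha F1^-1 P1 A (A^-1 C P2)]
   cancels the constant term. *)
have Ycvg : mxcvg (fun t => mslice M (Y t) k)
    (invmx (mslice M A k) *m mslice M C k *m mslice M P2 k).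
  apply: (@mxcvg_affine_recl _ _ _
    (1%:M - alpha%:C *: (invmx (mslice M F1 k) *m (mslice M F1 k - mslice M G1 k)))
    _ _ _ _ _ _ (@mxcvg_cst _ _ _ (alpha%:C *:
      (invmx (mslice M F1 k) *m mslice M P1 k *m mslice M C k *m mslice M P2 k)))).
  - apply: (@norm_eigenvalue_relax _ _ _ _ alpha _ _ halpha0 _ _ halpha).
    + by move=> z; apply: eigenvalue_relaxl.
    + by rewrite tspectral_radius_ge0.
    + by rewrite -F1V -(msliceM hM); apply: spectral_radius_le.
  - move=> t; rewrite YS; move: (tinv M F1) F1V => F1i F1V.
    rewrite msliceD msliceZ !(msliceM hM) msliceB (mslice1 hM) msliceZ.
    rewrite !(msliceM hM) F1V.
    by rewrite -split1 !mulmxA.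
  - rewrite -split1 mulmxBl mul1mx -scalemxAl.
    by rewrite !mulmxA (mulmxK (uA k)) subrK.
(* The [X] step already uses the updated [Y k.+1], hence the shifted sequence. *)
have Ycvg' := proj2 (mxcvgS _ _) Ycvg.
apply: (@mxcvg_affine_recr _ _ _
    (1%:M - beta%:C *: ((mslice M F2 k - mslice M G2 k) *m invmx (mslice M F2 k)))
    _ (fun t => mslice M (Y t.+1) k *m (beta%:C *: invmx (mslice M F2 k))) _ _ _ _
    (mxcvgM Ycvg' (@mxcvg_cst _ _ _ _))).
- apply: (@norm_eigenvalue_relax _ _ _ _ beta _ _ hbeta0 _ _ hbeta).
  + by move=> z; apply: eigenvalue_relaxr.
  + by rewrite tspectral_radius_ge0.
  + by rewrite -F2V -(msliceM hM); apply: spectral_radius_le.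
- move=> t; rewrite XS; move: (tinv M F2) F2V => F2i F2V.
  rewrite msliceD msliceZ !(msliceM hM) msliceB (mslice1 hM) msliceZ.
  rewrite !(msliceM hM) F2V.
  by rewrite -split2 -scalemxAr.
(* The fixed-point equation holds because [A^-1 C B^-1 (B P2 F2^-1) = (A^-1 C P2) F2^-1], so the two
   [beta] terms cancel. *)
- move: (tinv M A) (tinv M B) hAV hBV => Ai Bi hAV hBV.
  rewrite !(msliceM hM) hAV hBV.
  rewrite -split2 mulmxBr mulmx1 -!scalemxAr.
  by rewrite !mulmxA (mulmxKV (uB k)) subrK.
Qed.
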